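(* Let $(H,D_H)$ and $(K,D_K)$ be cocommutative difference Hopf algebras such that $K$ is an $H$-module bialgebra via an action $\rightharpoonup$. The smash product Hopf algebra $K\# H$ has a unique difference operator $D$ such that $D|_K=D_K$ and $D|_H=D_H$ (that is, $D(x\#1)=D_K(x)\#1$ and $D(1\#a)=1\#D_H(a)$ for all $x\in K$, $a\in H$) if and only if $(K,D_K)$ is a difference $(H,D_H)$-module bialgebra.
   Context: Everything is over a field $\mathbf{k}$ of characteristic $0$. Sweedler notation: $\Delta(a)=a_1\otimes a_2$, etc. A difference operator on a Hopf algebra $H$ is a coalgebra homomorphism $D:H\to H$ with $D(xy)=D(x_1)x_2D(y)S(x_3)$ for all $x,y\in H$; the pair $(H,D)$ is then a difference Hopf algebra. $K$ is an $H$-module bialgebra via an algebra action $\rightharpoonup:H\to\mathrm{End}(K)$ if $a\rightharpoonup 1=\varepsilon(a)1$, $a\rightharpoonup(xy)=(a_1\rightharpoonup x)(a_2\rightharpoonup y)$, $\varepsilon_K(a\rightharpoonup x)=\varepsilon_H(a)\varepsilon_K(x)$ and $\Delta_K(a\rightharpoonup x)=(a_1\rightharpoonup x_1)\otimes(a_2\rightharpoonup x_2)$. For cocommutative $H$, the smash product Hopf algebra $K\#H$ is $K\otimes H$ with multiplication $(x\# a)(y\# b)=x(a_1\rightharpoonup y)\# a_2b$, the tensor product coalgebra structure, and antipode $S(x\# a)=(S_H(a_1)\rightharpoonup S_K(x))\# S_H(a_2)$. $K$ and $H$ are identified with $K\#1$ and $1\#H$. For cocommutative difference Hopf algebras $(K,D_K)$,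 $(H,D_H)$, the pair $(K,D_K)$ is a difference $(H,D_H)$-module bialgebra via $\rightharpoonup$ if $K$ is an $H$-module bialgebra via $\rightharpoonup$ and $$(D_K*\mathrm{id})(a\rightharpoonup x)=(D_H*\mathrm{id})(a)\rightharpoonup(D_K*\mathrm{id})(x),\quad\forall x\in K,\ a\in H,$$ where $(D*\mathrm{id})(x)=D(x_1)x_2$ is the convolution product. *)

(* Defs.v *)
From HB Require Import structures.
From mathcomp Require Import all_boot all_order all_algebra.
From mathcomp Require Import ring.
From mathcomp Require Import boolp.

Set Implicit Arguments.
Unset Strict Implicit.
Unset Printing Implicit Defensive.

Import GRing.Theory.
Local Open Scope ring_scope.
Local Open Scope quotient_scope.

(* Sums of elementary tensors v (x) w, as lists of pairs (v, w), modulo the   *)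
(* congruence generated by bilinearity.                                       *)
Section Tensor.
Context {k : fieldType} (V W : lmodType k).

Inductive tensor_rel : seq (V * W) -> seq (V * W) -> Prop :=
| tensor_rel_refl s : tensor_rel s s
| tensor_rel_sym s t : tensor_rel s t -> tensor_rel t s
| tensor_rel_trans s t u : tensor_rel s t -> tensor_rel t u -> tensor_rel s u
| tensor_rel_cat s s' t t' :
    tensor_rel s s' -> tensor_rel t t' -> tensor_rel (s ++ t) (s' ++ t')
| tensor_rel_catC s t : tensor_rel (s ++ t) (t ++ s)
| tensor_rel_0l w : tensor_rel [:: (0, w)] [::]
| tensor_rel_Dl v v' w :
    tensor_rel [:: (v + v', w)] [:: (v, w); (v', w)]
| tensor_rel_Dr v w w' :
    tensor_rel [:: (v, w + w')] [:: (v, w); (v, w')]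
| tensor_rel_Z c v w : tensor_rel [:: (c *: v, w)] [:: (v, c *: w)].

Definition tensor_eqv : rel (seq (V * W)) := fun s t => `[< tensor_rel s t >].

Lemma tensor_eqv_equiv : equiv_class_of tensor_eqv.
Proof.
split.
- by move=> s; apply/asboolP; apply: tensor_rel_refl.
- by move=> s t; apply/asboolP/asboolP; apply: tensor_rel_sym.
- move=> t s u /asboolP st /asboolP tu; apply/asboolP.
  exact: tensor_rel_trans st tu.
Qed.

Canonical tensor_equiv := EquivRelPack tensor_eqv_equiv.

Definition tensor : Type := {eq_quot tensor_equiv}.
HB.instance Definition _ := Choice.on tensor.
HB.instance Definition _ := EqQuotient.on tensor.

Lemma tensor_eqP s t : tensor_rel s t <-> \pi_tensor s = \pi_tensor t.
Proof.
split=> [st|/eqquotP/asboolP//].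
by apply/eqquotP/asboolP.
Qed.

Lemma tensor_piW (P : tensor -> Prop) :
  (forall s, P (\pi_tensor s)) -> forall x, P x.
Proof. by move=> Ppi x; rewrite -[x]reprK. Qed.

Let zscale (c : k) (s : seq (V * W)) := [seq (c *: p.1, p.2) | p <- s].

Lemma tensor_rel_scale c s t : tensor_rel s t -> tensor_rel (zscale c s) (zscale c t).
Proof.
elim=> {s t}.
- by move=> s; apply: tensor_rel_refl.
- by move=> s t _; apply: tensor_rel_sym.
- by move=> s t u _ st _ tu; apply: tensor_rel_trans st tu.
- by move=> s s' t t' _ ss _ tt; rewrite /zscale !map_cat; apply: tensor_rel_cat.
- by move=> s t; rewrite /zscale !map_cat; apply: tensor_rel_catC.
- by move=> w; rewrite /= scaler0; apply: tensor_rel_0l.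
- by move=> v v' w; rewrite /= scalerDr; apply: tensor_rel_Dl.
- by move=> v w w'; apply: tensor_rel_Dr.
- by move=> d v w; rewrite /= scalerA mulrC -scalerA; apply: tensor_rel_Z.
Qed.

Definition tensor_zero : tensor := \pi_tensor [::].
Definition tensor_add (x y : tensor) : tensor := \pi_tensor (repr x ++ repr y).
Definition tensor_scale (c : k) (x : tensor) : tensor :=
  \pi_tensor [seq (c *: p.1, p.2) | p <- repr x].
Definition tensor_opp (x : tensor) : tensor := tensor_scale (-1) x.

Lemma tensor_reprP s : tensor_rel (repr (\pi_tensor s)) s.
Proof. by apply/tensor_eqP; rewrite reprK. Qed.

Lemma tensor_addE s t :
  tensor_add (\pi_tensor s) (\pi_tensor t) = \pi_tensor (s ++ t).
Proof. by apply/tensor_eqP; apply: tensor_rel_cat; apply: tensor_reprP. Qed.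

Lemma tensor_pi_cons p s :
  \pi_tensor (p :: s) = tensor_add (\pi_tensor [:: p]) (\pi_tensor s).
Proof. by rewrite tensor_addE. Qed.

Lemma tensor_scaleE c s :
  tensor_scale c (\pi_tensor s) = \pi_tensor (zscale c s).
Proof. by apply/tensor_eqP; apply: tensor_rel_scale; apply: tensor_reprP. Qed.

Lemma tensor_addA : associative tensor_add.
Proof.
move=> x y z; elim/tensor_piW: x => x; elim/tensor_piW: y => y; elim/tensor_piW: z => z.
by rewrite !tensor_addE catA.
Qed.

Lemma tensor_addC : commutative tensor_add.
Proof.
move=> x y; elim/tensor_piW: x => x; elim/tensor_piW: y => y; rewrite !tensor_addE.
by apply/tensor_eqP; apply: tensor_rel_catC.
Qed.

Lemma tensor_add0 : left_id tensor_zero tensor_add.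
Proof. by move=> x; elim/tensor_piW: x => x; rewrite tensor_addE. Qed.

Lemma tensor_scaleD c : {morph tensor_scale c : x y / tensor_add x y}.
Proof.
move=> x y; elim/tensor_piW: x => x; elim/tensor_piW: y => y.
by rewrite tensor_addE !tensor_scaleE tensor_addE /zscale map_cat.
Qed.

Lemma tensor_scaleDl x : {morph tensor_scale^~ x : a b / a + b >-> tensor_add a b}.
Proof.
elim/tensor_piW: x => s a b; rewrite !tensor_scaleE tensor_addE.
elim: s => [|[v w] s IH]; first by [].
rewrite /= (tensor_pi_cons _ (zscale (a + b) s)) IH.
rewrite (tensor_pi_cons _ (zscale a s ++ _)) -!tensor_addE.
rewrite (tensor_pi_cons _ (zscale b s)).
rewrite scalerDl.
have -> : \pi_tensor [:: (a *: v + b *: v, w)] =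
    tensor_add (\pi_tensor [:: (a *: v, w)]) (\pi_tensor [:: (b *: v, w)]).
  by rewrite tensor_addE; apply/tensor_eqP; apply: tensor_rel_Dl.
rewrite -!tensor_addA; congr tensor_add.
by rewrite !tensor_addA; congr tensor_add; rewrite tensor_addC.
Qed.

Lemma tensor_scaleA a b x :
  tensor_scale a (tensor_scale b x) = tensor_scale (a * b) x.
Proof.
elim/tensor_piW: x => s; rewrite !tensor_scaleE /zscale -map_comp.
by congr (\pi_tensor _); apply: eq_map => -[v w] /=; rewrite scalerA.
Qed.

Lemma tensor_scale1 : left_id 1 tensor_scale.
Proof.
move=> x; elim/tensor_piW: x => s; rewrite tensor_scaleE /zscale; congr (\pi_tensor _).
by rewrite -[RHS]map_id; apply: eq_map => -[v w] /=; rewrite scale1r.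
Qed.

Lemma tensor_scale0 x : tensor_scale 0 x = tensor_zero.
Proof.
elim/tensor_piW: x => s; rewrite tensor_scaleE.
elim: s => [|[v w] s IH] //=.
rewrite /= (tensor_pi_cons _ (zscale 0 s)) IH tensor_addC tensor_add0 scale0r.
by apply/tensor_eqP; apply: tensor_rel_0l.
Qed.

Lemma tensor_addN : left_inverse tensor_zero tensor_opp tensor_add.
Proof.
move=> x; rewrite -[in X in tensor_add _ X](tensor_scale1 x) /tensor_opp.
by rewrite -tensor_scaleDl addNr tensor_scale0.
Qed.

HB.instance Definition _ := GRing.isZmodule.Build tensor
  tensor_addA tensor_addC tensor_add0 tensor_addN.
HB.instance Definition _ := GRing.Zmodule_isLmodule.Build k tensor
  tensor_scaleA tensor_scale1 tensor_scaleD tensor_scaleDl.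

Definition tens (v : V) (w : W) : tensor := \pi_tensor [:: (v, w)].

(* tsum f t is the value at t of the map induced by f; it does not depend on  *)
(* the chosen representative when f is bilinear (tsum_tens, lin_tsum).       *)
Definition tsum (M : lmodType k) (f : V -> W -> M) (t : tensor) : M :=
  \sum_(p <- repr t) f p.1 p.2.

End Tensor.

Notation "v \ox w" := (tens v w) (at level 40, left associativity) : ring_scope.

(* Sweedler notation: \sw_(a1, a2 <- comul a) f a1 a2 is f(a_1, a_2). *)
Notation "\sw_ ( a1 , a2 <- t ) e" := (tsum (fun a1 a2 => e) t)
  (at level 41, e at level 41, a1 name, a2 name, t at level 35,
   format "\sw_ ( a1 ,  a2  <-  t )  e") : ring_scope.

Definition is_lin (k : fieldType) (V M : lmodType k) (f : V -> M) : Prop :=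
  forall c u v, f (c *: u + v) = c *: f u + f v.

Definition is_bilin (k : fieldType) (V W M : lmodType k) (f : V -> W -> M) :=
  (forall v, is_lin (f v)) /\ (forall w, is_lin (fun v => f v w)).

Section LinTheory.
Context {k : fieldType}.
Implicit Types V W M N : lmodType k.

Lemma is_lin0 V M (f : V -> M) : is_lin f -> f 0 = 0.
Proof. by move=> /(_ (-1) 0 0); rewrite scaler0 addr0 scaleN1r addNr. Qed.

Lemma is_linD V M (f : V -> M) u v : is_lin f -> f (u + v) = f u + f v.
Proof. by move=> /(_ 1 u v); rewrite !scale1r. Qed.

Lemma is_linZ V M (f : V -> M) c v : is_lin f -> f (c *: v) = c *: f v.
Proof. by move=> fl; have := fl c v 0; rewrite !addr0 (is_lin0 fl) addr0. Qed.

Lemma is_lin_sum V M (f : V -> M) I (r : seq I) (F : I -> V) :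
  is_lin f -> f (\sum_(i <- r) F i) = \sum_(i <- r) f (F i).
Proof.
move=> fl; elim: r => [|i r IH]; first by rewrite !big_nil is_lin0.
by rewrite !big_cons (is_linD _ _ fl) IH.
Qed.

Lemma tens_Dl V W (v v' : V) (w : W) : (v + v') \ox w = v \ox w + v' \ox w.
Proof.
rewrite {2 3}/tens [RHS]tensor_addE.
by apply/tensor_eqP; apply: tensor_rel_Dl.
Qed.

Lemma tens_Dr V W (v : V) (w w' : W) : v \ox (w + w') = v \ox w + v \ox w'.
Proof.
rewrite {2 3}/tens [RHS]tensor_addE.
by apply/tensor_eqP; apply: tensor_rel_Dr.
Qed.

Lemma tens_Zl V W c (v : V) (w : W) : (c *: v) \ox w = c *: (v \ox w).
Proof. by rewrite {2}/tens [RHS]tensor_scaleE. Qed.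

Lemma tens_Zr V W c (v : V) (w : W) : v \ox (c *: w) = c *: (v \ox w).
Proof.
by rewrite -tens_Zl; apply/tensor_eqP; apply/tensor_rel_sym/tensor_rel_Z.
Qed.

Lemma tensor_pi_sum V W (s : seq (V * W)) :
  \pi_(tensor V W) s = \sum_(p <- s) p.1 \ox p.2.
Proof.
elim: s => [|p s IH]; first by rewrite big_nil.
by rewrite big_cons -IH tensor_pi_cons; case: p.
Qed.

Lemma tsumE V W (t : tensor V W) : \sw_(v, w <- t) (v \ox w) = t.
Proof. by rewrite /tsum -tensor_pi_sum reprK. Qed.

Lemma tensor_rel_sum V W M (f : V -> W -> M) s t : is_bilin f ->
  tensor_rel s t -> \sum_(p <- s) f p.1 p.2 = \sum_(p <- t) f p.1 p.2.
Proof.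
move=> [fr fl]; elim=> {s t}.
- by [].
- by move=> s t _ ->.
- by move=> s t u _ -> _ ->.
- by move=> s s' t t' _ + _; rewrite !big_cat /= => -> ->.
- by move=> s t; rewrite !big_cat /= addrC.
- by move=> w; rewrite big_seq1 big_nil /= (is_lin0 (fl w)).
- by move=> v v' w; rewrite !big_cons !big_nil !addr0 /= (is_linD _ _ (fl w)).
- by move=> v w w'; rewrite !big_cons !big_nil !addr0 /= (is_linD _ _ (fr v)).
- move=> c v w; rewrite !big_seq1 /= (is_linZ _ _ (fr v)).
  by rewrite (is_linZ _ _ (fl w)).
Qed.

Lemma tsum_pi V W M (f : V -> W -> M) s : is_bilin f ->
  tsum f (\pi_(tensor V W) s) = \sum_(p <- s) f p.1 p.2.
Proof. by move=> fb; apply: tensor_rel_sum fb _; apply: tensor_reprP. Qed.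

Lemma tsum_tens V W M (f : V -> W -> M) v w : is_bilin f -> tsum f (v \ox w) = f v w.
Proof. by move=> fb; rewrite tsum_pi // big_seq1. Qed.

Lemma lin_tsum V W M (f : V -> W -> M) : is_bilin f -> is_lin (tsum f).
Proof.
move=> fb c s t.
rewrite -[s]reprK -[t]reprK.
rewrite [_ *: _]tensor_scaleE [_ + _ in LHS]tensor_addE !tsum_pi //.
rewrite big_cat /= big_map /= scaler_sumr; congr (_ + _).
by apply: eq_bigr => p _; rewrite (is_linZ _ _ (fb.2 _)).
Qed.

Lemma eq_tsum V W M (f g : V -> W -> M) t :
  (forall v w, f v w = g v w) -> tsum f t = tsum g t.
Proof. by move=> fg; apply: eq_bigr. Qed.

Lemma tsum_push V W M N (g : M -> N) (f : V -> W -> M) t : is_lin g ->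
  g (tsum f t) = \sw_(v, w <- t) g (f v w).
Proof. by move=> gl; rewrite /tsum is_lin_sum. Qed.

Lemma tsum_swap V W V' W' M (f : V -> W -> V' -> W' -> M) t s :
  \sw_(v, w <- t) \sw_(v', w' <- s) f v w v' w' =
  \sw_(v', w' <- s) \sw_(v, w <- t) f v w v' w'.
Proof. exact: exchange_big. Qed.

Lemma tsum_tsum V W V' W' M (f : V' -> W' -> M) (g : V -> W -> tensor V' W') t :
  is_bilin f -> tsum f (tsum g t) = \sw_(v, w <- t) tsum f (g v w).
Proof. by move=> fb; apply: tsum_push; apply: lin_tsum. Qed.

Lemma tens_ext V W M (f g : tensor V W -> M) : is_lin f -> is_lin g ->
  (forall v w, f (v \ox w) = g (v \ox w)) -> forall t, f t = g t.
Proof.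
by move=> fl gl fg t; rewrite -[t]tsumE !tsum_push //; apply: eq_tsum.
Qed.

Lemma lin_id V : is_lin (fun v : V => v).
Proof. by []. Qed.

Lemma lin_linear V M N (h : {linear M -> N}) (g : V -> M) :
  is_lin g -> is_lin (fun v => h (g v)).
Proof. by move=> gl c u v; rewrite gl linearP. Qed.

Lemma lin_comp V M N (h : M -> N) (g : V -> M) :
  is_lin h -> is_lin g -> is_lin (fun v => h (g v)).
Proof. by move=> hl gl c u v; rewrite gl hl. Qed.

Lemma lin_tsum_arg V V' W' M (f : V' -> W' -> M) (g : V -> tensor V' W') :
  is_bilin f -> is_lin g -> is_lin (fun v => tsum f (g v)).
Proof. by move=> fb; apply: lin_comp; apply: lin_tsum. Qed.

Lemma lin_tsum_par V V' W' M (f : V -> V' -> W' -> M) (t : tensor V' W') :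
  (forall v' w', is_lin (fun v => f v v' w')) -> is_lin (fun v => tsum (f v) t).
Proof.
move=> fl c u v; rewrite /tsum scaler_sumr -big_split /=.
by apply: eq_bigr => p _; rewrite fl.
Qed.

Lemma lin_tensl V V' W' (g : V -> V') (w : W') :
  is_lin g -> is_lin (fun v => g v \ox w).
Proof. by move=> gl c u v; rewrite gl tens_Dl tens_Zl. Qed.

Lemma lin_tensr V V' W' (v' : V') (g : V -> W') :
  is_lin g -> is_lin (fun v => v' \ox g v).
Proof. by move=> gl c u v; rewrite gl tens_Dr tens_Zr. Qed.

Lemma lin_mull V (A : algType k) (g : V -> A) (b : A) :
  is_lin g -> is_lin (fun v => g v * b).
Proof. by move=> gl c u v; rewrite gl mulrDl -scalerAl. Qed.

Lemma lin_mulr V (A : algType k) (a : A) (g : V -> A) :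
  is_lin g -> is_lin (fun v => a * g v).
Proof. by move=> gl c u v; rewrite gl mulrDr -scalerAr. Qed.

Lemma lin_scaler V M (c : k) (g : V -> M) :
  is_lin g -> is_lin (fun v => c *: g v).
Proof. by move=> gl d u v; rewrite gl scalerDr !scalerA mulrC. Qed.

Lemma lin_scalel V V' M (e : {scalar V'}) (g : V -> V') (m : M) :
  is_lin g -> is_lin (fun v => e (g v) *: m).
Proof. by move=> gl d u v; rewrite gl linearP scalerDl scalerA. Qed.

End LinTheory.

(* Solves is_lin and is_bilin goals; extended by redefining lin_hook. *)
Ltac lin_hook := fail.
Ltac lin := repeat (intros; cbv beta; match goal with
  | _ => assumption
  | |- is_bilin _ => split
  | |- is_lin (fun v => v) => exact: lin_id
  | |- is_lin (fun v => tens (@?f v) (@?g v)) =>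
      first [apply: lin_tensl | apply: lin_tensr]
  | |- is_lin (fun v => @?f v * @?g v) => first [apply: lin_mull | apply: lin_mulr]
  | |- is_lin (fun v => @?f v *: @?g v) => first [apply: lin_scaler | apply: lin_scalel]
  | |- is_lin (fun v => tsum (@?f v) (@?t v)) =>
      first [apply: lin_tsum_par | apply: lin_tsum_arg]
  | |- is_lin ( *%R _) => apply: lin_mulr
  | |- is_lin (tens _) => apply: lin_tensr
  | |- is_lin (tsum _) => apply: lin_tsum
  | |- is_lin ( *:%R _) => apply: lin_scaler
  | _ => first [lin_hook | apply: lin_linear]
  end).

HB.mixin Record hasCoalgebra (k : fieldType) V of GRing.Lmodule k V := {
  comul : V -> tensor V V;
  counit : V -> k;
  comul_is_linear : linear comul;
  counit_is_scalar : scalar counit;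
  coassoc : forall a,
    \sw_(a1, a2 <- comul a) \sw_(a11, a12 <- comul a1) (a11 \ox (a12 \ox a2)) =
    \sw_(a1, a2 <- comul a) (a1 \ox comul a2);
  counitl : forall a, \sw_(a1, a2 <- comul a) (counit a1 *: a2) = a;
  counitr : forall a, \sw_(a1, a2 <- comul a) (counit a2 *: a1) = a;
}.

#[short(type="coalgType")]
HB.structure Definition Coalgebra (k : fieldType) :=
  {V of GRing.Lmodule k V & hasCoalgebra k V}.

HB.instance Definition _ (k : fieldType) (V : coalgType k) :=
  GRing.isLinear.Build k V (tensor V V) *:%R (@comul k V) (@comul_is_linear k V).
HB.instance Definition _ (k : fieldType) (V : coalgType k) :=
  GRing.isLinear.Build k V k *%R (@counit k V) (@counit_is_scalar k V).

HB.mixin Record isBialgebra (k : fieldType) H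
    of Coalgebra k H & GRing.Algebra k H := {
  comul1 : comul (1 : H) = 1 \ox 1;
  comulM : forall a b : H, comul (a * b) =
    \sw_(a1, a2 <- comul a) \sw_(b1, b2 <- comul b) ((a1 * b1) \ox (a2 * b2));
  counit1 : counit (1 : H) = 1;
  counitM : forall a b : H, counit (a * b) = counit a * counit b;
}.

#[short(type="bialgType")]
HB.structure Definition Bialgebra (k : fieldType) :=
  {H of Coalgebra k H & GRing.Algebra k H & isBialgebra k H}.

HB.mixin Record hasAntipode (k : fieldType) H of Bialgebra k H := {
  antipode : H -> H;
  antipode_is_linear : linear antipode;
  antipodel : forall a : H,
    \sw_(a1, a2 <- comul a) (antipode a1 * a2) = counit a *: 1;
  antipoder : forall a : H,
    \sw_(a1, a2 <- comul a) (a1 * antipode a2) = counit a *: 1;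
}.

#[short(type="hopfAlgType")]
HB.structure Definition HopfAlgebra (k : fieldType) :=
  {H of Bialgebra k H & hasAntipode k H}.

HB.instance Definition _ (k : fieldType) (H : hopfAlgType k) :=
  GRing.isLinear.Build k H H *:%R (@antipode k H) (@antipode_is_linear k H).

HB.mixin Record isCocommutative (k : fieldType) V of Coalgebra k V := {
  cocomm : forall a : V, \sw_(a1, a2 <- comul a) (a2 \ox a1) = comul a;
}.

#[short(type="cocommHopfAlgType")]
HB.structure Definition CocommHopfAlgebra (k : fieldType) :=
  {H of HopfAlgebra k H & isCocommutative k H}.

Section Sweedler.
Context {k : fieldType}.
Implicit Types M : lmodType k.

Lemma coassoc_sw (V : coalgType k) M (f : V -> V -> V -> M) (a : V) :
  (forall u v, is_lin (f u v)) -> (forall u w, is_lin (fun v => f u v w)) ->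
  (forall v w, is_lin (fun u => f u v w)) ->
  \sw_(a1, a2 <- comul a) \sw_(a11, a12 <- comul a1) f a11 a12 a2 =
  \sw_(a1, a2 <- comul a) \sw_(a21, a22 <- comul a2) f a1 a21 a22.
Proof.
move=> f3 f2 f1.
have fb : is_bilin (fun u t => tsum (f u) t).
  by split=> [v|t]; [apply: lin_tsum | apply: lin_tsum_par => v w].
have := congr1 (tsum (fun u t => tsum (f u) t)) (coassoc a).
rewrite !tsum_tsum // => E.
transitivity (\sw_(v, w <- comul a) tsum (fun u t => tsum (f u) t)
    (\sw_(a11, a12 <- comul v) (a11 \ox (a12 \ox w)))).
  apply: eq_tsum => a1 a2; rewrite tsum_tsum //; apply: eq_tsum => u v.
  by rewrite tsum_tens // tsum_tens.
by rewrite E; apply: eq_tsum => a1 a2; rewrite tsum_tens.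
Qed.

Lemma counitl_sw (V : coalgType k) M (f : V -> M) (a : V) : is_lin f ->
  \sw_(a1, a2 <- comul a) (counit a1 *: f a2) = f a.
Proof.
move=> fl; rewrite -{2}[a]counitl tsum_push //.
by apply: eq_tsum => u v; rewrite is_linZ.
Qed.

Lemma counitr_sw (V : coalgType k) M (f : V -> M) (a : V) : is_lin f ->
  \sw_(a1, a2 <- comul a) (counit a2 *: f a1) = f a.
Proof.
move=> fl; rewrite -{2}[a]counitr tsum_push //.
by apply: eq_tsum => u v; rewrite is_linZ.
Qed.

Lemma comul1_sw (H : bialgType k) M (f : H -> H -> M) : is_bilin f ->
  tsum f (comul 1) = f 1 1.
Proof. by move=> fb; rewrite comul1 tsum_tens. Qed.

Lemma comulM_sw (H : bialgType k) M (f : H -> H -> M) (a b : H) : is_bilin f ->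
  tsum f (comul (a * b)) =
  \sw_(a1, a2 <- comul a) \sw_(b1, b2 <- comul b) f (a1 * b1) (a2 * b2).
Proof.
move=> fb; rewrite comulM tsum_tsum //; apply: eq_tsum => a1 a2.
by rewrite tsum_tsum //; apply: eq_tsum => b1 b2; rewrite tsum_tens.
Qed.

Lemma antipodel_sw (H : hopfAlgType k) M (f : H -> M) (a : H) : is_lin f ->
  \sw_(a1, a2 <- comul a) f (antipode a1 * a2) = counit a *: f 1.
Proof. by move=> fl; rewrite -tsum_push // antipodel is_linZ. Qed.

Lemma antipoder_sw (H : hopfAlgType k) M (f : H -> M) (a : H) : is_lin f ->
  \sw_(a1, a2 <- comul a) f (a1 * antipode a2) = counit a *: f 1.
Proof. by move=> fl; rewrite -tsum_push // antipoder is_linZ. Qed.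

Lemma cocomm_sw (H : cocommHopfAlgType k) M (f : H -> H -> M) (a : H) :
  is_bilin f -> tsum f (comul a) = \sw_(a1, a2 <- comul a) f a2 a1.
Proof.
move=> fb; rewrite -[in LHS]cocomm tsum_tsum //.
by apply: eq_tsum => a1 a2; rewrite tsum_tens.
Qed.

(* a_1 (x) a_2 (x) a_3 (x) a_4 = a_1 (x) a_3 (x) a_2 (x) a_4 *)
Lemma cocomm4_sw (H : cocommHopfAlgType k) M (f : H -> H -> H -> H -> M) (a : H) :
  (forall u v w, is_lin (f u v w)) ->
  (forall u v z, is_lin (fun w => f u v w z)) ->
  (forall u w z, is_lin (fun v => f u v w z)) ->
  (forall v w z, is_lin (fun u => f u v w z)) ->
  \sw_(a1, a2 <- comul a) \sw_(a11, a12 <- comul a1) \sw_(a21, a22 <- comul a2)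
    f a11 a12 a21 a22 =
  \sw_(a1, a2 <- comul a) \sw_(a11, a12 <- comul a1) \sw_(a21, a22 <- comul a2)
    f a11 a21 a12 a22.
Proof.
move=> f4 f3 f2 f1.
rewrite (coassoc_sw (f := fun u v w =>
  \sw_(w1, w2 <- comul w) f u v w1 w2)); [|by lin..].
rewrite (coassoc_sw (f := fun u v w =>
  \sw_(w1, w2 <- comul w) f u w1 v w2)); [|by lin..].
apply: eq_tsum => u v.
rewrite -(coassoc_sw (f := fun p q r => f u p q r)) //.
rewrite -(coassoc_sw (f := fun p q r => f u q p r)) //.
by apply: eq_tsum => p q; rewrite cocomm_sw.
Qed.

(* Uniqueness of convolution inverses, in the algebra H (x) H *)
Lemma antipode_comul (H : cocommHopfAlgType k) (a : H) :
  comul (antipode a) = \sw_(a1, a2 <- comul a) (antipode a1 \ox antipode a2).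
Proof.
pose m (s t : tensor H H) : tensor H H :=
  \sw_(s1, s2 <- s) \sw_(t1, t2 <- t) ((s1 * t1) \ox (s2 * t2)).
have ml t : is_lin (m^~ t) by rewrite /m; lin.
have mr s : is_lin (m s) by rewrite /m; lin.
have mE s1 s2 t1 t2 : m (s1 \ox s2) (t1 \ox t2) = (s1 * t1) \ox (s2 * t2).
  by rewrite /m tsum_tens; [rewrite tsum_tens //; lin | lin].
have mD u v : m (comul u) (comul v) = comul (u * v) by rewrite comulM.
have m1l t : m (1 \ox 1) t = t.
  move: t; apply: tens_ext => // v w.
  by rewrite mE !mul1r.
have m1r t : m t (1 \ox 1) = t.
  move: t; apply: tens_ext => // v w.
  by rewrite mE !mulr1.
have mA s t u : m s (m t u) = m (m s t) u.
  move: s; apply: tens_ext; [by move=> c p q; rewrite ml| |move=> s1 s2].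
    by move=> c p q; rewrite !ml.
  move: t; apply: tens_ext; [by move=> c p q; rewrite !(ml,mr)| |move=> t1 t2].
    by move=> c p q; rewrite mr ml.
  move: u; apply: tens_ext; [by move=> c p q; rewrite !mr| |move=> u1 u2].
    by move=> c p q; rewrite mr.
  by rewrite !mE !mulrA.
pose SS (b : H) := \sw_(b1, b2 <- comul b) (antipode b1 \ox antipode b2).
have SSl : is_lin SS by rewrite /SS; lin.
have inv b : \sw_(b1, b2 <- comul b) m (comul b1) (SS b2) = counit b *: (1 \ox 1).
  transitivity (\sw_(b1, b2 <- comul b) \sw_(b11, b12 <- comul b1)
     \sw_(b21, b22 <- comul b2) ((b11 * antipode b21) \ox (b12 * antipode b22))).
    apply: eq_tsum => b1 b2; rewrite /m; apply: eq_tsum => p q.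
    rewrite /SS tsum_tsum; last by lin.
    by apply: eq_tsum => r s; rewrite tsum_tens; [|lin].
  rewrite (cocomm4_sw (f := fun p q r s => (p * antipode r) \ox (q * antipode s)));
    [|by lin..].
  transitivity (\sw_(b1, b2 <- comul b) (counit b1 *: (counit b2 *: (1 : H) \ox (1 : H)))).
    apply: eq_tsum => b1 b2.
    transitivity (\sw_(b11, b12 <- comul b1)
      ((b11 * antipode b12) \ox \sw_(b21, b22 <- comul b2) (b21 * antipode b22))).
      by apply: eq_tsum => p q; rewrite tsum_push //; lin.
    rewrite antipoder (antipoder_sw (f := fun x => x \ox _)); last by lin.
    by rewrite tens_Zr tens_Zl.
  by rewrite (counitl_sw (f := fun x => counit x *: _ \ox 1)) ?tens_Zl //; lin.
transitivity (\sw_(a1, a2 <- comul a) \sw_(a21, a22 <- comul a2)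
   m (comul (antipode a1)) (m (comul a21) (SS a22))).
  transitivity (\sw_(a1, a2 <- comul a) (counit a2 *: comul (antipode a1))).
    by rewrite (counitr_sw (f := fun x => comul (antipode x))) //; lin.
  apply: eq_tsum => a1 a2.
  by rewrite -(tsum_push (g := m _)) // inv (is_linZ _ _ (mr _)) m1r.
have mSSl c : is_lin (fun w => m c (SS w)) by apply: lin_comp.
rewrite -(coassoc_sw (f := fun u v w => m (comul (antipode u)) (m (comul v) (SS w)))).
- transitivity (\sw_(a1, a2 <- comul a) (counit a1 *: SS a2)); last by rewrite counitl_sw.
  apply: eq_tsum => a1 a2.
  transitivity (m (comul (\sw_(a11, a12 <- comul a1) (antipode a11 * a12))) (SS a2)).
    rewrite (tsum_push (g := fun x => m (comul x) (SS a2))).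
      by apply: eq_tsum => u v; rewrite mA mD.
    by apply: (lin_comp (ml _)); lin.
  by rewrite antipodel linearZ /= comul1 (is_linZ _ _ (ml _)) m1l.
- by move=> u v; apply: lin_comp.
- move=> u w; apply: lin_comp => //; apply: (lin_comp (ml _)); lin.
- move=> v w; apply: (lin_comp (ml _)); lin.
Qed.

Lemma comul_antipode_sw (H : cocommHopfAlgType k) M (f : H -> H -> M) (a : H) :
  is_bilin f -> tsum f (comul (antipode a)) =
  \sw_(a1, a2 <- comul a) f (antipode a1) (antipode a2).
Proof.
move=> fb; rewrite antipode_comul tsum_tsum //.
by apply: eq_tsum => u v; rewrite tsum_tens.
Qed.

Lemma counit_antipode (H : hopfAlgType k) (a : H) :
  counit (antipode a) = counit a.
Proof.
have := congr1 counit (antipodel a).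
rewrite linearZ /= counit1 mulr1 => <-.
rewrite -[in LHS](counitr a) [LHS](tsum_push (M := H) (N := k^o)
  (g := fun x => counit (antipode x) : k^o)); last first.
  by move=> c u v; rewrite !linearP.
rewrite [RHS](tsum_push (M := H) (N := k^o) (g := fun x => counit x : k^o)); last first.
  by move=> c u v; rewrite linearP.
by apply: eq_bigr => p _; rewrite counitM !linearZ /= mulrC.
Qed.

End Sweedler.

Record moduleBialgebra (k : fieldType) (H K : bialgType k) := ModuleBialgebra {
  act :> H -> K -> K;
  act_linearl : forall x, linear (fun a => act a x);
  act_linearr : forall a, linear (act a);
  act_id : forall x, act 1 x = x;
  act_comp : forall a b x, act (a * b) x = act a (act b x);
  act_one : forall a, act a 1 = counit a *: 1;
  act_mul : forall a x y,
    act a (x * y) = \sw_(a1, a2 <- comul a) (act a1 x * act a2 y);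
  act_counit : forall a x, counit (act a x) = counit a * counit x;
  act_comul : forall a x, comul (act a x) =
    \sw_(a1, a2 <- comul a) \sw_(x1, x2 <- comul x) (act a1 x1 \ox act a2 x2);
}.

Lemma lin_actl (k : fieldType) (H K : bialgType k) (r : moduleBialgebra H K)
    (V : lmodType k) (g : V -> H) x : is_lin g -> is_lin (fun v => r (g v) x).
Proof. by move=> gl c u v; rewrite gl; apply: act_linearl. Qed.

Lemma lin_actr (k : fieldType) (H K : bialgType k) (r : moduleBialgebra H K)
    (V : lmodType k) (g : V -> K) a : is_lin g -> is_lin (fun v => r a (g v)).
Proof. by move=> gl c u v; rewrite gl; apply: act_linearr. Qed.

Ltac lin_hook ::= first [apply: lin_actl | apply: lin_actr].

Section Smash.
Context {k : fieldType} {H : cocommHopfAlgType k} {K : hopfAlgType k}.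
Variable r : moduleBialgebra H K.
Local Notation T := (tensor K H).

Definition smash_one : T := 1 \ox 1.
Definition smash_mul (s t : T) : T :=
  \sw_(x, a <- s) \sw_(y, b <- t) \sw_(a1, a2 <- comul a)
    ((x * r a1 y) \ox (a2 * b)).
Definition smash_comul (s : T) : tensor T T :=
  \sw_(x, a <- s) \sw_(x1, x2 <- comul x) \sw_(a1, a2 <- comul a)
    ((x1 \ox a1) \ox (x2 \ox a2)).
Definition smash_counit (s : T) : k :=
  tsum (M := k^o) (fun x a => counit x * counit a) s.
Definition smash_antipode (s : T) : T :=
  \sw_(x, a <- s) \sw_(a1, a2 <- comul a)
    (r (antipode a1) (antipode x) \ox antipode a2).

Lemma lin_smash_mull t : is_lin (fun s => smash_mul s t).
Proof. by rewrite /smash_mul; lin. Qed.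

Lemma lin_smash_mulr s : is_lin (smash_mul s).
Proof. by rewrite /smash_mul; lin. Qed.

Lemma lin_smash_comul : is_lin smash_comul.
Proof. by rewrite /smash_comul; lin. Qed.

Lemma bilin_counit : is_bilin (fun (x : K) (a : H) => counit x * counit a : k^o).
Proof.
split=> [x|a] c u v; first by rewrite linearP mulrDr /= mulrCA.
by rewrite linearP mulrDl /= -mulrA.
Qed.

Lemma lin_smash_counit : is_lin (smash_counit : T -> k^o).
Proof. by apply: lin_tsum; apply: bilin_counit. Qed.

Lemma lin_smash_antipode : is_lin smash_antipode.
Proof. by rewrite /smash_antipode; lin. Qed.

Lemma smash_mulE x a y b : smash_mul (x \ox a) (y \ox b) =
  \sw_(a1, a2 <- comul a) ((x * r a1 y) \ox (a2 * b)).
Proof. by rewrite /smash_mul tsum_tens; [rewrite tsum_tens; [|lin]|lin]. Qed.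

Lemma smash_comulE x a : smash_comul (x \ox a) =
  \sw_(x1, x2 <- comul x) \sw_(a1, a2 <- comul a)
    ((x1 \ox a1) \ox (x2 \ox a2)).
Proof. by rewrite /smash_comul tsum_tens; [|lin]. Qed.

Lemma smash_counitE x a : smash_counit (x \ox a) = counit x * counit a.
Proof. by rewrite /smash_counit tsum_tens //; apply: bilin_counit. Qed.

Lemma smash_antipodeE x a : smash_antipode (x \ox a) =
  \sw_(a1, a2 <- comul a) (r (antipode a1) (antipode x) \ox antipode a2).
Proof. by rewrite /smash_antipode tsum_tens; [|lin]. Qed.

Let lml := lin_smash_mull.
Let lmr := lin_smash_mulr.

Lemma lin_smash_mulL (V : lmodType k) (g : V -> T) t :
  is_lin g -> is_lin (fun v => smash_mul (g v) t).
Proof. by move=> gl; apply: (lin_comp (lml t) gl). Qed.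

Lemma lin_smash_mulR (V : lmodType k) (g : V -> T) t :
  is_lin g -> is_lin (fun v => smash_mul t (g v)).
Proof. by move=> gl; apply: (lin_comp (lmr t) gl). Qed.

Lemma lin_smash_comulC (V : lmodType k) (g : V -> T) :
  is_lin g -> is_lin (fun v => smash_comul (g v)).
Proof. exact/lin_comp/lin_smash_comul. Qed.

Lemma lin_smash_antipodeC (V : lmodType k) (g : V -> T) :
  is_lin g -> is_lin (fun v => smash_antipode (g v)).
Proof. exact/lin_comp/lin_smash_antipode. Qed.

Lemma lin_smash_counitZ (V V' : lmodType k) (g : V -> T) (m : V') :
  is_lin g -> is_lin (fun v => smash_counit (g v) *: m).
Proof.
by move=> gl c u v; rewrite gl lin_smash_counit scalerDl scalerA.
Qed.

Ltac lin_hook ::= first [apply: lin_actl | apply: lin_actr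
  | apply: lin_smash_mulL | apply: lin_smash_mulR | apply: lin_smash_comulC
  | apply: lin_smash_antipodeC | apply: lin_smash_counitZ].

Lemma smash_mul1 : left_id smash_one smash_mul.
Proof.
apply: tens_ext => [||x a]; [exact: lmr|exact: lin_id|].
by rewrite smash_mulE comul1_sw ?act_id ?mul1r //; lin.
Qed.

Lemma smash_mulr1 : right_id smash_one smash_mul.
Proof.
apply: tens_ext => [||x a]; [exact: lml|exact: lin_id|].
rewrite smash_mulE -[RHS](counitl_sw (f := fun a => x \ox a)); last by lin.
apply: eq_tsum => a1 a2.
by rewrite act_one mulr1 -scalerAr mulr1 tens_Zl.
Qed.

Lemma smash_mulA : associative smash_mul.
Proof.
move=> s t u; move: s; apply: tens_ext; [exact: lml | | move=> x a].
  by lin.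
move: t; apply: tens_ext; [| |move=> y b].
- by lin.
- by lin.
move: u; apply: tens_ext; [| exact: lmr |move=> z c].
  by lin.
rewrite !smash_mulE (tsum_push (g := smash_mul _)); last exact: lmr.
rewrite (tsum_push (g := smash_mul^~ _)); last exact: lml.
transitivity (\sw_(b1, b2 <- comul b) \sw_(a1, a2 <- comul a)
  \sw_(a11, a12 <- comul a1) ((x * (r a11 y * r a12 (r b1 z))) \ox (a2 * (b2 * c)))).
  apply: eq_tsum => b1 b2; rewrite smash_mulE; apply: eq_tsum => a1 a2.
  by rewrite act_mul (tsum_push (g := fun v => (x * v) \ox _)) //; lin.
rewrite tsum_swap.
transitivity (\sw_(a1, a2 <- comul a) \sw_(a11, a12 <- comul a1)
  \sw_(b1, b2 <- comul b) ((x * (r a11 y * r a12 (r b1 z))) \ox (a2 * (b2 * c)))).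
  by apply: eq_tsum => a1 a2; rewrite tsum_swap.
rewrite (coassoc_sw (f := fun a1 a2 a3 => \sw_(b1, b2 <- comul b)
  ((x * (r a1 y * r a2 (r b1 z))) \ox (a3 * (b2 * c))))); [|by lin..].
apply: eq_tsum => a1 a2; rewrite smash_mulE comulM_sw; last by lin.
apply: eq_tsum => a21 a22; apply: eq_tsum => b1 b2.
by rewrite act_comp !mulrA.
Qed.

Lemma smash_mulDl : left_distributive smash_mul +%R.
Proof. by move=> s t u; rewrite (is_linD _ _ (lml u)). Qed.

Lemma smash_mulDr : right_distributive smash_mul +%R.
Proof. by move=> s t u; rewrite (is_linD _ _ (lmr s)). Qed.

Lemma smash_one_neq0 : smash_one != 0.
Proof.
apply/eqP => /(congr1 smash_counit).
rewrite smash_counitE !counit1 mulr1 (is_lin0 lin_smash_counit).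
by apply/eqP; apply: oner_neq0.
Qed.

Lemma smash_scaleAl (c : k) s t : c *: smash_mul s t = smash_mul (c *: s) t.
Proof. by rewrite (is_linZ _ _ (lml t)). Qed.

Lemma smash_scaleAr (c : k) s t : c *: smash_mul s t = smash_mul s (c *: t).
Proof. by rewrite (is_linZ _ _ (lmr s)). Qed.

Lemma smash_comul_sw (V : lmodType k) (f : T -> T -> V) x a : is_bilin f ->
  tsum f (smash_comul (x \ox a)) =
  \sw_(x1, x2 <- comul x) \sw_(a1, a2 <- comul a) f (x1 \ox a1) (x2 \ox a2).
Proof.
move=> fb; rewrite smash_comulE tsum_tsum //; apply: eq_tsum => x1 x2.
by rewrite tsum_tsum //; apply: eq_tsum => a1 a2; rewrite tsum_tens.
Qed.

Lemma smash_coassoc s :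
  \sw_(s1, s2 <- smash_comul s) \sw_(s11, s12 <- smash_comul s1)
     (s11 \ox (s12 \ox s2)) =
  \sw_(s1, s2 <- smash_comul s) (s1 \ox smash_comul s2).
Proof.
move: s; apply: tens_ext => [||x a]; [by lin..|].
rewrite !smash_comul_sw; [|by lin..].
transitivity (\sw_(x1, x2 <- comul x) \sw_(x11, x12 <- comul x1)
  \sw_(a1, a2 <- comul a) \sw_(a11, a12 <- comul a1)
    ((x11 \ox a11) \ox ((x12 \ox a12) \ox (x2 \ox a2)))).
  apply: eq_tsum => x1 x2; rewrite tsum_swap; apply: eq_tsum => a1 a2.
  by rewrite smash_comul_sw; [|by lin].
rewrite (coassoc_sw (f := fun x1 x2 x3 => \sw_(a1, a2 <- comul a)
  \sw_(a11, a12 <- comul a1)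
    ((x1 \ox a11) \ox ((x2 \ox a12) \ox (x3 \ox a2))))); [|by lin..].
apply: eq_tsum => x1 x2.
transitivity (\sw_(x21, x22 <- comul x2) \sw_(a1, a2 <- comul a)
  \sw_(a21, a22 <- comul a2)
    ((x1 \ox a1) \ox ((x21 \ox a21) \ox (x22 \ox a22)))).
  by apply: eq_tsum => x21 x22; apply: coassoc_sw; lin.
rewrite tsum_swap; apply: eq_tsum => a1 a2.
rewrite smash_comulE tsum_push; last by lin.
by apply: eq_tsum => x21 x22; rewrite tsum_push //; lin.
Qed.

Lemma smash_counitl s :
  \sw_(s1, s2 <- smash_comul s) (smash_counit s1 *: s2) = s.
Proof.
move: s; apply: tens_ext => [||x a]; [by lin..|].
rewrite smash_comul_sw; [|by lin].
rewrite -[RHS](counitl_sw (f := fun x => x \ox a)); last by lin.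
apply: eq_tsum => x1 x2.
rewrite -[in RHS](counitl_sw (f := fun a => x2 \ox a)); last by lin.
rewrite tsum_push; last by lin.
by apply: eq_tsum => a1 a2; rewrite smash_counitE scalerA.
Qed.

Lemma smash_counitr s :
  \sw_(s1, s2 <- smash_comul s) (smash_counit s2 *: s1) = s.
Proof.
move: s; apply: tens_ext => [||x a]; [by lin..|].
rewrite smash_comul_sw; [|by lin].
rewrite -[RHS](counitr_sw (f := fun x => x \ox a)); last by lin.
apply: eq_tsum => x1 x2.
rewrite -[in RHS](counitr_sw (f := fun a => x1 \ox a)); last by lin.
rewrite tsum_push; last by lin.
by apply: eq_tsum => a1 a2; rewrite smash_counitE scalerA.
Qed.

Lemma smash_comul1 : smash_comul smash_one = smash_one \ox smash_one.
Proof.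
rewrite smash_comulE comul1_sw; [|by lin].
by rewrite comul1_sw //; lin.
Qed.

Lemma smash_counit1 : smash_counit smash_one = 1.
Proof. by rewrite smash_counitE !counit1 mulr1. Qed.

Lemma smash_counitM s t :
  smash_counit (smash_mul s t) = smash_counit s * smash_counit t.
Proof.
have cl := lin_smash_counit.
move: s; apply: (tens_ext (M := k^o)) => [||x a].
- exact: lin_comp cl (lml t).
- by move=> c u v; rewrite cl mulrDl /GRing.scale /= mulrA.
move: t; apply: (tens_ext (M := k^o)) => [||y b].
- exact: lin_comp cl (lmr _).
- by move=> c u v; rewrite cl mulrDr /GRing.scale /= mulrCA.
rewrite smash_mulE !smash_counitE.
rewrite (tsum_push (N := k^o) (g := smash_counit)) //.
transitivity (counit (\sw_(a1, a2 <- comul a) (counit a1 *: a2))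
  * (counit x * counit y * counit b)); last first.
  by rewrite counitl; ring.
rewrite (tsum_push (M := H) (N := k^o) (g := fun a => counit a : k^o)); last first.
  by move=> c u v; rewrite linearP.
rewrite /tsum mulr_suml; apply: eq_bigr => p _.
by rewrite smash_counitE !counitM act_counit linearZ /=; ring.
Qed.

Lemma smash_comulM s t : smash_comul (smash_mul s t) =
  \sw_(s1, s2 <- smash_comul s) \sw_(t1, t2 <- smash_comul t)
    (smash_mul s1 t1 \ox smash_mul s2 t2).
Proof.
move: s; apply: tens_ext => [||x a]; [by lin..|].
move: t; apply: tens_ext => [||y b]; [by lin..|].
transitivity (\sw_(a1, a2 <- comul a) \sw_(a11, a12 <- comul a1)
  \sw_(a21, a22 <- comul a2) \sw_(x1, x2 <- comul x) \sw_(y1, y2 <- comul y)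
  \sw_(b1, b2 <- comul b)
    (((x1 * r a11 y1) \ox (a21 * b1)) \ox ((x2 * r a12 y2) \ox (a22 * b2)))).
  rewrite smash_mulE tsum_push; last by lin.
  apply: eq_tsum => a1 a2; rewrite smash_comulE comulM_sw; last by lin.
  transitivity (\sw_(x1, x2 <- comul x) \sw_(a11, a12 <- comul a1)
    \sw_(a21, a22 <- comul a2) \sw_(y1, y2 <- comul y) \sw_(b1, b2 <- comul b)
    (((x1 * r a11 y1) \ox (a21 * b1)) \ox ((x2 * r a12 y2) \ox (a22 * b2)))); last first.
    rewrite tsum_swap; apply: eq_tsum => a11 a12.
    by rewrite tsum_swap; apply: eq_tsum.
  apply: eq_tsum => x1 x2.
  rewrite act_comul tsum_tsum; last by lin.
  apply: eq_tsum => a11 a12.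
  rewrite tsum_tsum; last by lin.
  rewrite tsum_swap; apply: eq_tsum => y1 y2.
  rewrite tsum_tens; last by lin.
  by rewrite comulM_sw; last by lin.
rewrite (cocomm4_sw (f := fun a11 a12 a21 a22 => \sw_(x1, x2 <- comul x)
  \sw_(y1, y2 <- comul y) \sw_(b1, b2 <- comul b)
    (((x1 * r a11 y1) \ox (a21 * b1)) \ox ((x2 * r a12 y2) \ox (a22 * b2)))));
  [|by lin..].
rewrite smash_comul_sw; last by lin.
transitivity (\sw_(a1, a2 <- comul a) \sw_(x1, x2 <- comul x)
  \sw_(a11, a12 <- comul a1) \sw_(a21, a22 <- comul a2)
  \sw_(y1, y2 <- comul y) \sw_(b1, b2 <- comul b)
    (((x1 * r a11 y1) \ox (a12 * b1)) \ox ((x2 * r a21 y2) \ox (a22 * b2)))).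
  apply: eq_tsum => a1 a2.
  by rewrite [RHS]tsum_swap; apply: eq_tsum => a11 a12; rewrite [RHS]tsum_swap.
rewrite tsum_swap; apply: eq_tsum => x1 x2; apply: eq_tsum => a1 a2.
rewrite smash_comul_sw; last by lin.
transitivity (\sw_(y1, y2 <- comul y) \sw_(a11, a12 <- comul a1)
  \sw_(a21, a22 <- comul a2) \sw_(b1, b2 <- comul b)
    (((x1 * r a11 y1) \ox (a12 * b1)) \ox ((x2 * r a21 y2) \ox (a22 * b2)))).
  by rewrite [RHS]tsum_swap; apply: eq_tsum => a11 a12; rewrite [RHS]tsum_swap.
apply: eq_tsum => y1 y2.
transitivity (\sw_(b1, b2 <- comul b) \sw_(a11, a12 <- comul a1)
  \sw_(a21, a22 <- comul a2)
    (((x1 * r a11 y1) \ox (a12 * b1)) \ox ((x2 * r a21 y2) \ox (a22 * b2)))).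
  by rewrite [RHS]tsum_swap; apply: eq_tsum => a11 a12; rewrite [RHS]tsum_swap.
apply: eq_tsum => b1 b2.
rewrite !smash_mulE (tsum_push (g := fun u => u \ox _)); last by lin.
by apply: eq_tsum => a11 a12; rewrite tsum_push //; lin.
Qed.

Lemma smash_antipoder s : \sw_(s1, s2 <- smash_comul s)
  smash_mul s1 (smash_antipode s2) = smash_counit s *: smash_one.
Proof.
move: s; apply: tens_ext => [||x a]; [by lin..|].
rewrite smash_comul_sw; last by lin.
transitivity (\sw_(x1, x2 <- comul x) ((x1 * antipode x2) \ox (counit a *: (1 : H)))).
  apply: eq_tsum => x1 x2.
  transitivity (\sw_(a1, a2 <- comul a) \sw_(a11, a12 <- comul a1)
    \sw_(a21, a22 <- comul a2)
      ((x1 * r a11 (r (antipode a21) (antipode x2))) \ox (a12 * antipode a22))).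
    apply: eq_tsum => a1 a2; rewrite smash_antipodeE tsum_push; last by lin.
    rewrite tsum_swap; apply: eq_tsum => a21 a22.
    by rewrite smash_mulE.
  rewrite (cocomm4_sw (f := fun a11 a12 a21 a22 =>
    (x1 * r a11 (r (antipode a21) (antipode x2))) \ox (a12 * antipode a22)));
    [|by lin..].
  rewrite -[in RHS](counitl_sw (f := fun b => (_ * _) \ox (counit b *: (1 : H))));
    last by lin.
  apply: eq_tsum => a1 a2.
  transitivity (\sw_(a11, a12 <- comul a1)
    ((x1 * r (a11 * antipode a12) (antipode x2)) \ox (counit a2 *: (1 : H)))).
    apply: eq_tsum => a11 a12; rewrite act_comp -antipoder.
    by rewrite (tsum_push (g := tens _)) //; lin.
  rewrite (antipoder_sw (f := fun b => (x1 * r b (antipode x2)) \ox _)); last by lin.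
  by rewrite act_id.
rewrite (antipoder_sw (f := fun b => b \ox _)); last by lin.
by rewrite tens_Zr scalerA smash_counitE.
Qed.

Lemma smash_antipodel s : \sw_(s1, s2 <- smash_comul s)
  smash_mul (smash_antipode s1) s2 = smash_counit s *: smash_one.
Proof.
move: s; apply: tens_ext => [||x a]; [by lin..|].
rewrite smash_comul_sw; last by lin.
transitivity (\sw_(a1, a2 <- comul a) \sw_(a11, a12 <- comul a1)
  \sw_(x1, x2 <- comul x)
    (r (antipode a11) (antipode x1 * x2) \ox (antipode a12 * a2))).
  rewrite tsum_swap; apply: eq_tsum => a1 a2.
  rewrite [RHS]tsum_swap; apply: eq_tsum => x1 x2.
  transitivity (\sw_(a11, a12 <- comul a1) \sw_(a121, a122 <- comul a12)
    ((r (antipode a11) (antipode x1) * r (antipode a121) x2)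
       \ox (antipode a122 * a2))).
    rewrite smash_antipodeE (tsum_push (g := fun u => smash_mul u _)); last by lin.
    apply: eq_tsum => a11 a12; rewrite smash_mulE comul_antipode_sw //; lin.
  rewrite -(coassoc_sw (f := fun a1 a2 a3 =>
    (r (antipode a1) (antipode x1) * r (antipode a2) x2) \ox (antipode a3 * _)));
    [|by lin..].
  apply: eq_tsum => a11 a12.
  rewrite act_mul comul_antipode_sw; last by lin.
  by rewrite (tsum_push (g := fun u => u \ox _)) //; lin.
transitivity (\sw_(a1, a2 <- comul a) (counit x *: ((1 : K) \ox (antipode a1 * a2)))).
  apply: eq_tsum => a1 a2.
  rewrite -(counitl_sw (f := fun b => counit x *: (1 \ox (antipode b * a2))));
    last by lin.
  apply: eq_tsum => a11 a12.
  rewrite (antipodel_sw (f := fun y => r (antipode a11) y \ox _)); last by lin.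
  by rewrite act_one counit_antipode tens_Zl scalerA mulrC scalerA.
rewrite (antipodel_sw (f := fun b => counit x *: (1 \ox b))); last by lin.
by rewrite scalerA mulrC smash_counitE.
Qed.

End Smash.

(* An alias of K (x) H carrying the smash product Hopf algebra structure. *)
Definition smash (k : fieldType) (H : cocommHopfAlgType k) (K : hopfAlgType k)
  (r : moduleBialgebra H K) : Type := tensor K H.

Section SmashInstances.
Context {k : fieldType} {H : cocommHopfAlgType k} {K : hopfAlgType k}.
Variable r : moduleBialgebra H K.

HB.instance Definition _ := GRing.Lmodule.on (smash r).
HB.instance Definition _ := GRing.Zmodule_isNzRing.Build (smash r)
  (smash_mulA r) (smash_mul1 r) (smash_mulr1 r)
  (smash_mulDl r) (smash_mulDr r) (@smash_one_neq0 k H K).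
HB.instance Definition _ :=
  GRing.Lmodule_isLalgebra.Build k (smash r) (smash_scaleAl r).
HB.instance Definition _ :=
  GRing.Lalgebra_isAlgebra.Build k (smash r) (smash_scaleAr r).
HB.instance Definition _ := hasCoalgebra.Build k (smash r)
  (@lin_smash_comul k H K) (@lin_smash_counit k H K) (@smash_coassoc k H K)
  (@smash_counitl k H K) (@smash_counitr k H K).
HB.instance Definition _ := isBialgebra.Build k (smash r)
  (@smash_comul1 k H K) (smash_comulM r) (@smash_counit1 k H K) (smash_counitM r).
HB.instance Definition _ := hasAntipode.Build k (smash r)
  (lin_smash_antipode r) (smash_antipodel r) (smash_antipoder r).
End SmashInstances.

Definition smash_tens (k : fieldType) (H : cocommHopfAlgType k)
  (K : hopfAlgType k) (r : moduleBialgebra H K) (x : K) (a : H) : smash r :=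
  x \ox a.
Notation "x \# a" := (smash_tens _ x a)
  (at level 40, left associativity) : ring_scope.

Section SmashSpec.
Context {k : fieldType} {H : cocommHopfAlgType k} {K : hopfAlgType k}.
Variable r : moduleBialgebra H K.
Implicit Types (x y : K) (a b : H).

Lemma smashM x a y b : (x \# a) * (y \# b) =
  \sw_(a1, a2 <- comul a) ((x * r a1 y) \# (a2 * b)) :> smash r.
Proof. exact: smash_mulE. Qed.

Lemma smash1 : 1 = 1 \# 1 :> smash r.
Proof. by []. Qed.

Lemma comul_smash x a : comul (x \# a : smash r) =
  \sw_(x1, x2 <- comul x) \sw_(a1, a2 <- comul a) ((x1 \# a1) \ox (x2 \# a2)).
Proof. exact: smash_comulE. Qed.

Lemma counit_smash x a : counit (x \# a : smash r) = counit x * counit a.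
Proof. exact: smash_counitE. Qed.

Lemma antipode_smash x a : antipode (x \# a : smash r) =
  \sw_(a1, a2 <- comul a) (r (antipode a1) (antipode x) \# antipode a2).
Proof. exact: smash_antipodeE. Qed.

End SmashSpec.

Record is_difference_operator (k : fieldType) (H : hopfAlgType k)
    (D : H -> H) : Prop := IsDifferenceOperator {
  diff_linear : linear D;
  diff_comul : forall x,
    comul (D x) = \sw_(x1, x2 <- comul x) (D x1 \ox D x2);
  diff_counit : forall x, counit (D x) = counit x;
  diffM : forall x y, D (x * y) =
    \sw_(x1, x' <- comul x) \sw_(x2, x3 <- comul x')
      (D x1 * x2 * D y * antipode x3);
}.

Definition convolution (k : fieldType) (H : hopfAlgType k) (f g : H -> H) (x : H)
  : H := \sw_(x1, x2 <- comul x) (f x1 * g x2).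

(* The compatibility of an action with difference operators; K being an       *)
(* H-module bialgebra is part of the type of r.                               *)
Definition is_difference_module_bialgebra (k : fieldType)
    (H K : cocommHopfAlgType k) (DH : H -> H) (DK : K -> K)
    (r : moduleBialgebra H K) : Prop :=
  forall (a : H) (x : K),
    convolution DK id (r a x) = r (convolution DH id a) (convolution DK id x).

(* Main.v *)
Require Import Defs.
From HB Require Import structures.
From mathcomp Require Import all_boot all_order all_algebra.
From mathcomp Require Import boolp.

(** On a cocommutative Hopf algebra, difference operators are bialgebra
    endomorphisms in disguise.  Writing D(xy) = (D * id)(x_1) D(y) S(x_2), one
    sees that T = D * id is multiplicative; it is a coalgebra map because
    convolution preserves coalgebra maps in the cocommutative case.  Conversely
    D = T * S recovers D from T, and T * S is a difference operator for every
    bialgebra endomorphism T ([convolution_idM], [diff_convolution_antipode],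
    [convolution_idK]).

    Since K and H embed in the cocommutative Hopf algebra K # H as sub-Hopf
    algebras, this correspondence is compatible with restriction: D restricts
    to D_K and D_H iff T restricts to T_K = D_K * id and T_H = D_H * id.  As
    x # a = (x # 1)(1 # a), a multiplicative T with these restrictions can only
    be the map x # a |-> T_K(x) # T_H(a) ([smash_hom_map]), which gives
    uniqueness.  That map is always a coalgebra map ([chom_smash_map]), so D
    exists iff it is multiplicative.  The only products not already respected
    are (1 # a)(x # 1) = (a_1 -> x) # a_2, so multiplicativity amounts to
    T_K(a -> x) = T_H(a) -> T_K(x) ([smash_mapM], and [smash_map_act] for the
    converse), which is the definition of a difference module bialgebra. *)

Set Implicit Arguments.
Unset Strict Implicit.
Unset Printing Implicit Defensive.

Import GRing.Theory.
Local Open Scope ring_scope.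

(** * Convolution and the antipode *)

(* Linear maps known only through a hypothesis is_lin f, such as difference
   operators, become transparent to the linearity solver. *)
Ltac lin_hook ::= first [apply: lin_actl | apply: lin_actr
  | match goal with
    | fl : is_lin ?f |- is_lin (fun v => ?f (@?g v)) => apply: (lin_comp fl)
    | fl : is_lin ?f |- is_lin (fun v => ?f v) => exact: fl
    end].

Section Convolution.
Context {k : fieldType} {H : hopfAlgType k}.
Implicit Types (f g h : H -> H) (x y : H).

Lemma lin_antipode : is_lin (antipode : H -> H).
Proof. exact: linearP. Qed.

Lemma lin_convolution f g : is_lin f -> is_lin g -> is_lin (convolution f g).
Proof. by move=> fl gl; rewrite /convolution; lin. Qed.

Lemma convolutionA f g h x : is_lin f -> is_lin g -> is_lin h ->
  convolution (convolution f g) h x = convolution f (convolution g h) x.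
Proof.
move=> fl gl hl; rewrite /convolution.
transitivity (\sw_(x1, x2 <- comul x) \sw_(x11, x12 <- comul x1)
    (f x11 * g x12 * h x2)).
  by apply: eq_tsum => x1 x2; rewrite (tsum_push (g := fun u => u * _)) //; lin.
rewrite (coassoc_sw (f := fun u v w => f u * g v * h w)); [|by lin..].
apply: eq_tsum => x1 x2; rewrite [RHS]tsum_push; last by lin.
by apply: eq_tsum => u v; rewrite mulrA.
Qed.

Lemma convolution_idK f x : is_lin f ->
  convolution (convolution f id) antipode x = f x.
Proof.
move=> fl; rewrite convolutionA //; [|exact: lin_antipode].
rewrite -[RHS](counitr_sw (f := f)) //; apply: eq_tsum => x1 x2.
by rewrite /convolution antipoder -scalerAr mulr1.
Qed.

Lemma convolution_antipodeK f x : is_lin f ->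
  convolution (convolution f antipode) id x = f x.
Proof.
move=> fl; rewrite convolutionA //; [|exact: lin_antipode].
rewrite -[RHS](counitr_sw (f := f)) //; apply: eq_tsum => x1 x2.
by rewrite /convolution antipodel -scalerAr mulr1.
Qed.

Lemma antipode1 : antipode 1 = 1 :> H.
Proof.
have := antipodel (1 : H); rewrite comul1_sw ?mulr1; last by lin.
by rewrite counit1 scale1r.
Qed.

(** The map x (x) y |-> S(y) S(x) is a right convolution inverse of
    multiplication, and x (x) y |-> S(xy) a left one; comparing them inside
    S(x_1 y_1) x_2 y_2 S(y_3) S(x_3) gives the equality. *)
Lemma antipodeM x y : antipode (x * y) = antipode y * antipode x.
Proof.
have mulV u v : \sw_(u1, u2 <- comul u) \sw_(v1, v2 <- comul v)
    (u1 * v1 * (antipode v2 * antipode u2)) = (counit u * counit v) *: 1.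
  transitivity (\sw_(u1, u2 <- comul u) (counit v *: (u1 * antipode u2))).
    apply: eq_tsum => u1 u2.
    transitivity (\sw_(v1, v2 <- comul v)
        (u1 * (v1 * antipode v2) * antipode u2)).
      by apply: eq_tsum => v1 v2; rewrite !mulrA.
    rewrite (antipoder_sw (f := fun w => u1 * w * antipode u2)); last by lin.
    by rewrite mulr1.
  by rewrite (antipoder_sw (f := fun w => counit v *: w)) ?scalerA //; lin.
transitivity (\sw_(x1, x2 <- comul x) \sw_(y1, y2 <- comul y)
    \sw_(x21, x22 <- comul x2) \sw_(y21, y22 <- comul y2)
    (antipode (x1 * y1) * (x21 * y21 * (antipode y22 * antipode x22)))).
  transitivity (\sw_(x1, x2 <- comul x) \sw_(y1, y2 <- comul y)
      (counit x2 *: (counit y2 *: antipode (x1 * y1)))).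
    rewrite -[LHS](counitr_sw (f := fun u => antipode (u * y))); last by lin.
    apply: eq_tsum => x1 x2; rewrite -[in RHS]tsum_push; last by lin.
    by rewrite (counitr_sw (f := fun v => antipode (x1 * v))) //; lin.
  apply: eq_tsum => x1 x2; apply: eq_tsum => y1 y2.
  rewrite scalerA -[X in _ *: X]mulr1 scalerAr -mulV tsum_push; last by lin.
  by apply: eq_tsum => u v; rewrite tsum_push //; lin.
transitivity (\sw_(x1, x2 <- comul x) \sw_(x21, x22 <- comul x2)
    \sw_(y1, y2 <- comul y) \sw_(y21, y22 <- comul y2)
    (antipode (x1 * y1) * (x21 * y21 * (antipode y22 * antipode x22)))).
  by apply: eq_tsum => x1 x2; rewrite tsum_swap.
rewrite -(coassoc_sw (f := fun u v w => \sw_(y1, y2 <- comul y)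
    \sw_(y21, y22 <- comul y2)
    (antipode (u * y1) * (v * y21 * (antipode y22 * antipode w)))));
  [|by lin..].
rewrite -[RHS](counitl_sw (f := fun u => antipode y * antipode u)); last by lin.
apply: eq_tsum => x1 x2.
transitivity (\sw_(u, v <- comul x1) \sw_(y1, y2 <- comul y)
    \sw_(y11, y12 <- comul y1)
    (antipode (u * y11) * (v * y12) * (antipode y2 * antipode x2))).
  apply: eq_tsum => u v.
  rewrite -(coassoc_sw (f := fun p q s =>
    antipode (u * p) * (v * q * (antipode s * antipode x2)))); [|by lin..].
  by apply: eq_tsum => y1 y2; apply: eq_tsum => p q; rewrite -[RHS]mulrA.
rewrite tsum_swap.
rewrite -[in RHS](counitl_sw (f := fun v => antipode v * antipode x2)); last by lin.
rewrite [RHS]tsum_push; last by lin.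
apply: eq_tsum => y1 y2.
rewrite -(comulM_sw (f := fun p q => antipode p * q * _)); last by lin.
rewrite (antipodel_sw (f := fun p => p * _)); last by lin.
by rewrite counitM mul1r scalerA.
Qed.

End Convolution.

(** * Coalgebra homomorphisms *)

Record is_coalgebra_hom (k : fieldType) (V W : coalgType k) (f : V -> W) : Prop :=
  IsCoalgebraHom {
  chom_lin : is_lin f;
  chom_comul : forall x, comul (f x) = \sw_(x1, x2 <- comul x) (f x1 \ox f x2);
  chom_counit : forall x, counit (f x) = counit x;
}.

Section CoalgebraHom.
Context {k : fieldType}.

Lemma chom_sw (V W : coalgType k) (M : lmodType k) (f : V -> W)
    (F : W -> W -> M) x : is_coalgebra_hom f -> is_bilin F ->
  tsum F (comul (f x)) = \sw_(x1, x2 <- comul x) F (f x1) (f x2).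
Proof.
move=> [_ fc _] Fb; rewrite fc tsum_tsum //.
by apply: eq_tsum => u v; rewrite tsum_tens.
Qed.

Variable H : cocommHopfAlgType k.
Implicit Types (f g : H -> H) (x : H).

Lemma chom_id : is_coalgebra_hom (id : H -> H).
Proof. by split=> // x; rewrite tsumE. Qed.

Lemma chom_antipode : is_coalgebra_hom (antipode : H -> H).
Proof.
split; [exact: lin_antipode|exact: antipode_comul|exact: counit_antipode].
Qed.

(** Comultiplying f(x_1) g(x_2) yields f(x_1) g(x_3) (x) f(x_2) g(x_4);
    cocommutativity is what allows the two middle factors to be exchanged. *)
Lemma chom_convolution f g : is_coalgebra_hom f -> is_coalgebra_hom g ->
  is_coalgebra_hom (convolution f g).
Proof.
move=> fh gh; have fl := chom_lin fh; have gl := chom_lin gh.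
split; first exact: lin_convolution.
- move=> x; rewrite {1}/convolution tsum_push; last by lin.
  transitivity (\sw_(x1, x2 <- comul x) \sw_(x11, x12 <- comul x1)
      \sw_(x21, x22 <- comul x2) ((f x11 * g x21) \ox (f x12 * g x22))).
    apply: eq_tsum => x1 x2; rewrite comulM (chom_sw _ fh); last by lin.
    by apply: eq_tsum => u v; rewrite (chom_sw _ gh) //; lin.
  rewrite (cocomm4_sw (f := fun p q s t => (f p * g s) \ox (f q * g t)));
    [|by lin..].
  apply: eq_tsum => x1 x2.
  rewrite [in RHS]/convolution (tsum_push (g := fun u => u \ox _)); last by lin.
  by apply: eq_tsum => u v; rewrite tsum_push //; lin.
- move=> x.
  have cl : is_lin (counit : H -> k^o) by exact: linearP.
  rewrite [LHS](tsum_push (N := k^o) (g := counit)) //.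
  rewrite -[in RHS](counitl x) [RHS](tsum_push (N := k^o) (g := counit)) //.
  apply: (eq_tsum (M := k^o)) => u v.
  by rewrite counitM (chom_counit fh) (chom_counit gh) linearZ.
Qed.

End CoalgebraHom.

(** * Difference operators as bialgebra endomorphisms *)

Section DifferenceOperator.
Context {k : fieldType} {H : cocommHopfAlgType k}.
Implicit Types (D T : H -> H) (x y : H).

Lemma diff_chom D : is_difference_operator D -> is_coalgebra_hom D.
Proof. by case=> Dl Dc De _; split. Qed.

(** The defining identity in terms of D * id: this form makes the cancellation
    in [convolution_idM] visible. *)
Lemma diffM_convolution D x y : is_difference_operator D ->
  D (x * y) =
  \sw_(x1, x2 <- comul x) (convolution D id x1 * D y * antipode x2).
Proof.
move=> Dd; have Dl := chom_lin (diff_chom Dd).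
rewrite (diffM Dd).
rewrite -(coassoc_sw (f := fun u v w => D u * v * D y * antipode w)); [|by lin..].
apply: eq_tsum => x1 x2.
by rewrite /convolution (tsum_push (g := fun u => u * _ * _)) //; lin.
Qed.

(** The defining identity at x = y = 1 makes D(1) idempotent, and D(1) is
    group-like, hence invertible. *)
Lemma diff1 D : is_difference_operator D -> D 1 = 1.
Proof.
move=> Dd; have Dl := chom_lin (diff_chom Dd).
have DD : D 1 * D 1 = D 1.
  have /esym := diffM_convolution 1 1 Dd.
  have Cl := lin_convolution Dl (@lin_id _ _).
  rewrite comul1_sw /convolution; last by lin.
  by rewrite comul1_sw ?antipode1 ?mulr1 //; lin.
have VD : antipode (D 1) * D 1 = 1.
  have := antipodel (D 1); rewrite (chom_sw _ (diff_chom Dd)); last by lin.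
  by rewrite comul1_sw ?(diff_counit Dd) ?counit1 ?scale1r //; lin.
by have := congr1 ( *%R (antipode (D 1))) DD; rewrite mulrA VD mul1r.
Qed.

Lemma convolution_id1 D : is_difference_operator D -> convolution D id 1 = 1.
Proof.
move=> Dd; have Dl := chom_lin (diff_chom Dd).
by rewrite /convolution comul1_sw ?(diff1 Dd) ?mulr1 //; lin.
Qed.

(** D(x_1 y_1) x_2 y_2 = (D * id)(x_1) D(y_1) S(x_2) x_3 y_2, in which
    S(x_2) x_3 collapses to a counit. *)
Lemma convolution_idM D : is_difference_operator D ->
  {morph convolution D id : x y / x * y}.
Proof.
move=> Dd x y; have Dl := chom_lin (diff_chom Dd).
have Tl := lin_convolution Dl (@lin_id _ _).
transitivity (\sw_(x1, x2 <- comul x) \sw_(y1, y2 <- comul y)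
    (D (x1 * y1) * (x2 * y2))).
  by rewrite [LHS]comulM_sw //; lin.
rewrite tsum_swap [in RHS]/convolution [RHS]tsum_push; last by lin.
apply: eq_tsum => y1 y2.
transitivity (\sw_(x1, x2 <- comul x) \sw_(x11, x12 <- comul x1)
    (convolution D id x11 * D y1 * (antipode x12 * x2) * y2)).
  apply: eq_tsum => x1 x2; rewrite (diffM_convolution _ _ Dd) mulrA.
  rewrite (tsum_push (g := fun u => u * _ * _)); last by lin.
  by apply: eq_tsum => u v; rewrite !mulrA.
rewrite (coassoc_sw (f := fun u v w =>
  convolution D id u * D y1 * (antipode v * w) * y2)); [|by lin..].
rewrite mulrA.
rewrite -[RHS](counitr_sw (f := fun u => convolution D id u * D y1 * y2)); last by lin.
apply: eq_tsum => x1 x2.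
rewrite (antipodel_sw (f := fun u => _ * D y1 * u * y2)); last by lin.
by rewrite mulr1.
Qed.

(** Inverse of the passage from D to D * id. Since S is antimultiplicative,
    (T * S)(xy) = T(x_1) (T(y_1) S(y_2)) S(x_2). *)
Lemma diff_convolution_antipode T : is_coalgebra_hom T ->
  {morph T : x y / x * y} -> is_difference_operator (convolution T antipode).
Proof.
move=> Th TM; have Tl := chom_lin Th.
have [Dl Dc De] := chom_convolution Th (@chom_antipode _ H).
split=> // x y.
rewrite -(coassoc_sw (f := fun u v w => convolution T antipode u * v *
  convolution T antipode y * antipode w)); [|by lin..].
transitivity (\sw_(x1, x2 <- comul x)
    (T x1 * convolution T antipode y * antipode x2)).
  rewrite [LHS]comulM_sw; last by lin.
  apply: eq_tsum => x1 x2.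
  rewrite [in RHS]/convolution (tsum_push (g := fun u => _ * u * _)); last by lin.
  by apply: eq_tsum => y1 y2; rewrite TM antipodeM !mulrA.
apply: eq_tsum => x1 x2.
rewrite -[in LHS](convolution_antipodeK x1 Tl) [in LHS]/convolution -/(convolution _ _).
by rewrite (tsum_push (g := fun u => u * _ * _)) //; lin.
Qed.

End DifferenceOperator.

(** * Structure of the smash product *)

Section Smash.
Context {k : fieldType} {H K : cocommHopfAlgType k}.
Variable r : moduleBialgebra H K.
Implicit Types (x y : K) (a b : H).

Lemma lin_smashl (V : lmodType k) (g : V -> K) a :
  is_lin g -> is_lin (fun v => g v \# a : smash r).
Proof. exact: lin_tensl. Qed.

Lemma lin_smashr (V : lmodType k) x (g : V -> H) :
  is_lin g -> is_lin (fun v => x \# g v : smash r).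
Proof. exact: lin_tensr. Qed.

Ltac lin_hook ::= first [apply: lin_actl | apply: lin_actr
  | apply: lin_smashl | apply: lin_smashr
  | match goal with
    | fl : is_lin ?f |- is_lin (fun v => ?f (@?g v)) => apply: (lin_comp fl)
    | fl : is_lin ?f |- is_lin (fun v => ?f v) => exact: fl
    end].

Lemma smash_ext (M : lmodType k) (f g : smash r -> M) :
  is_lin f -> is_lin g -> (forall x a, f (x \# a) = g (x \# a)) -> f =1 g.
Proof. exact: tens_ext. Qed.

Lemma tsum_smash (M : lmodType k) (f : K -> H -> M) x a :
  is_bilin f -> tsum f (x \# a : smash r) = f x a.
Proof. exact: tsum_tens. Qed.

Lemma comul_smash_sw (M : lmodType k) (F : smash r -> smash r -> M) x a :
  is_bilin F -> tsum F (comul (x \# a : smash r)) =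
  \sw_(x1, x2 <- comul x) \sw_(a1, a2 <- comul a) F (x1 \# a1) (x2 \# a2).
Proof. exact: smash_comul_sw. Qed.

Lemma smash_cocomm (s : smash r) : \sw_(s1, s2 <- comul s) (s2 \ox s1) = comul s.
Proof.
have cl : is_lin (comul : smash r -> _) by exact: linearP.
move: s; apply: smash_ext => [||x a]; [by lin..|].
rewrite comul_smash_sw; last by lin.
rewrite cocomm_sw; last by lin.
rewrite comul_smash; apply: eq_tsum => x1 x2.
by rewrite cocomm_sw //; lin.
Qed.

HB.instance Definition _ := isCocommutative.Build k (smash r) smash_cocomm.

Lemma smash_mulKK x y : (x \# 1) * (y \# 1) = (x * y) \# 1 :> smash r.
Proof. by rewrite smashM comul1_sw ?act_id ?mulr1 //; lin. Qed.

Lemma smash_mulHH a b : (1 \# a) * (1 \# b) = 1 \# (a * b) :> smash r.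
Proof.
rewrite smashM -[RHS](counitl_sw (f := fun u => 1 \# (u * b) : smash r));
  last by lin.
by apply: eq_tsum => u v; rewrite act_one mul1r /smash_tens tens_Zl.
Qed.

Lemma smash_mulKH x a : (x \# 1) * (1 \# a) = x \# a :> smash r.
Proof. by rewrite smashM comul1_sw ?act_id ?mulr1 ?mul1r //; lin. Qed.

Lemma smash_mulHK x a :
  (1 \# a) * (x \# 1) = \sw_(a1, a2 <- comul a) (r a1 x \# a2) :> smash r.
Proof. by rewrite smashM; apply: eq_tsum => u v; rewrite mulr1 mul1r. Qed.

Lemma antipode_smashK x : antipode (x \# 1 : smash r) = antipode x \# 1.
Proof. by rewrite antipode_smash comul1_sw ?antipode1 ?act_id //; lin. Qed.

Lemma antipode_smashH a : antipode (1 \# a : smash r) = 1 \# antipode a.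
Proof.
rewrite antipode_smash -[RHS](counitl_sw (f := fun u => 1 \# antipode u : smash r));
  last by lin.
apply: eq_tsum => u v.
by rewrite antipode1 act_one counit_antipode /smash_tens tens_Zl.
Qed.

(** As K # 1 and 1 # H are sub-Hopf algebras, convolution commutes with
    restriction to them; this transports the correspondence between D and
    D * id to the two factors. *)
Lemma convolution_smashK (F G : smash r -> smash r) (f g : K -> K) x :
  is_lin F -> is_lin G ->
  (forall y, F (y \# 1) = f y \# 1) -> (forall y, G (y \# 1) = g y \# 1) ->
  convolution F G (x \# 1) = convolution f g x \# 1.
Proof.
move=> Fl Gl Ff Gg; rewrite [in LHS]/convolution comul_smash_sw; last by lin.
rewrite (tsum_push (g := fun u => u \# 1 : smash r)); last by lin.
apply: eq_tsum => u v; rewrite comul1_sw; last by lin.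
by rewrite Ff Gg smash_mulKK.
Qed.

Lemma convolution_smashH (F G : smash r -> smash r) (f g : H -> H) a :
  is_lin F -> is_lin G ->
  (forall b, F (1 \# b) = 1 \# f b) -> (forall b, G (1 \# b) = 1 \# g b) ->
  convolution F G (1 \# a) = 1 \# convolution f g a.
Proof.
move=> Fl Gl Ff Gg; rewrite [in LHS]/convolution comul_smash_sw; last by lin.
rewrite comul1_sw; last by lin.
rewrite (tsum_push (g := fun u => 1 \# u : smash r)); last by lin.
by apply: eq_tsum => u v; rewrite Ff Gg smash_mulHH.
Qed.

(** * Endomorphisms of the smash product induced from its factors *)

Definition smash_map (f : K -> K) (g : H -> H) (s : smash r) : smash r :=
  tsum (fun x a => f x \# g a : smash r) s.

Section SmashMap.
Variables (f : K -> K) (g : H -> H).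
Hypotheses (fh : is_coalgebra_hom f) (gh : is_coalgebra_hom g).
Let fl := chom_lin fh.
Let gl := chom_lin gh.

Lemma lin_smash_map : is_lin (smash_map f g).
Proof. by rewrite /smash_map; lin. Qed.

Lemma smash_mapE x a : smash_map f g (x \# a) = f x \# g a.
Proof. by rewrite /smash_map tsum_smash //; lin. Qed.

Lemma chom_smash_map : is_coalgebra_hom (smash_map f g).
Proof.
have ml := lin_smash_map.
have cl : is_lin (comul : smash r -> _) by exact: linearP.
split=> //.
- apply: smash_ext => [||x a]; [by lin..|].
  rewrite smash_mapE !comul_smash_sw; last by lin.
  rewrite comul_smash (chom_sw _ fh); last by lin.
  apply: eq_tsum => x1 x2; rewrite (chom_sw _ gh); last by lin.
  by apply: eq_tsum => a1 a2; rewrite !smash_mapE.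
- have el : is_lin (counit : smash r -> k^o) by exact: linearP.
  apply: (smash_ext (M := k^o)) => [||x a]; [by lin..|].
  by rewrite smash_mapE !counit_smash (chom_counit fh) (chom_counit gh).
Qed.

Lemma smash_mapM :
  {morph f : x y / x * y} -> {morph g : a b / a * b} ->
  (forall a x, f (r a x) = r (g a) (f x)) ->
  {morph smash_map f g : s t / s * t}.
Proof.
move=> fM gM fr s t; have ml := lin_smash_map.
move: s; apply: smash_ext => [||x a]; [by lin..|].
move: t; apply: smash_ext => [||y b]; [by lin..|].
rewrite !smash_mapE !smashM tsum_push // (chom_sw _ gh); last by lin.
by apply: eq_tsum => a1 a2; rewrite smash_mapE fM gM fr.
Qed.

End SmashMap.

Lemma smash_hom_map (T : smash r -> smash r) (f : K -> K) (g : H -> H) :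
  is_lin T -> is_lin f -> is_lin g -> {morph T : s t / s * t} ->
  (forall x, T (x \# 1) = f x \# 1) -> (forall a, T (1 \# a) = 1 \# g a) ->
  T =1 smash_map f g.
Proof.
move=> Tl fl gl TM TK TH; apply: smash_ext => [//||x a].
  by rewrite /smash_map; lin.
by rewrite -smash_mulKH TM TK TH smash_mulKH smash_mulKH /smash_map tsum_smash //; lin.
Qed.

(** The two sides are what remains of multiplicativity on (1 # a)(x # 1) after
    applying the counit of H to the second tensor factor. *)
Lemma smash_map_act (f : K -> K) (g : H -> H) a x :
  is_coalgebra_hom f -> is_coalgebra_hom g -> f 1 = 1 -> g 1 = 1 ->
  {morph smash_map f g : s t / s * t} -> f (r a x) = r (g a) (f x).
Proof.
move=> fh gh f1 g1 TM.
have fl := chom_lin fh; have gl := chom_lin gh; have ml := lin_smash_map fh gh.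
have := TM (1 \# a) (x \# 1).
rewrite !smash_mapE // f1 g1 !smash_mulHK tsum_push //.
move/(congr1 (tsum (fun y b => counit b *: y))).
rewrite !(tsum_push (V := H) (W := H) (g := tsum (V := K) (W := H) _)); [|by lin..].
set A := LHS; set B := RHS.
have -> : A = f (r a x).
  rewrite -(counitr_sw (f := fun b => f (r b x))); last by lin.
  apply: eq_tsum => u v; rewrite smash_mapE // tsum_smash; last by lin.
  by rewrite (chom_counit gh).
move=> ->; rewrite /B -(counitr_sw (f := fun b => r b (f x))); last by lin.
by apply: eq_tsum => u v; rewrite tsum_smash //; lin.
Qed.

End Smash.

Arguments smash_map {k H K} r f g s.

(** * Difference operators on the smash product *)

Theorem theorem5p8 (k : fieldType) (char_k : [pchar k] =i pred0)
    (H K : cocommHopfAlgType k) (DH : H -> H) (DK : K -> K)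
    (DH_diff : is_difference_operator DH) (DK_diff : is_difference_operator DK)
    (r : moduleBialgebra H K) :
  (exists! D : smash r -> smash r,
     [/\ is_difference_operator D,
         forall x : K, D (x \# 1) = DK x \# 1 &
         forall a : H, D (1 \# a) = 1 \# DH a])
  <-> is_difference_module_bialgebra DH DK r.
Proof.
have DHl := chom_lin (diff_chom DH_diff).
have DKl := chom_lin (diff_chom DK_diff).
have THh := chom_convolution (diff_chom DH_diff) (@chom_id _ H).
have TKh := chom_convolution (diff_chom DK_diff) (@chom_id _ K).
set TH := convolution DH id in THh *; set TK := convolution DK id in TKh *.
have TH1 : TH 1 = 1 := convolution_id1 DH_diff.
have TK1 : TK 1 = 1 := convolution_id1 DK_diff.
have forced (D : smash r -> smash r) : is_difference_operator D ->
    (forall x : K, D (x \# 1) = DK x \# 1) ->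
    (forall a : H, D (1 \# a) = 1 \# DH a) ->
  convolution D id =1 smash_map r TK TH.
  move=> Dd DDK DDH; have Dl := chom_lin (diff_chom Dd).
  apply: smash_hom_map.
  - exact: lin_convolution.
  - exact: chom_lin TKh.
  - exact: chom_lin THh.
  - exact: convolution_idM.
  - by move=> x; apply: convolution_smashK.
  - by move=> a; apply: convolution_smashH.
split=> [[D [[Dd DDK DDH] _]] a x|compat].
  apply: (smash_map_act a x TKh THh); move=> // s t.
  by rewrite -!(forced D) // convolution_idM.
(* [forced] leaves this as the only candidate. *)
exists (convolution (smash_map r TK TH) antipode).
have Th := chom_smash_map r TKh THh.
have Tl := chom_lin Th.
split; [split|].
- apply: diff_convolution_antipode => //.
  by apply: smash_mapM => //; apply: convolution_idM.
- move=> x; rewrite (convolution_smashK (f := TK) (g := antipode)) //.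
  + by rewrite convolution_idK.
  + exact: lin_antipode.
  + by move=> y; rewrite smash_mapE // TH1.
  + exact: antipode_smashK.
- move=> a; rewrite (convolution_smashH (f := TH) (g := antipode)) //.
  + by rewrite convolution_idK.
  + exact: lin_antipode.
  + by move=> b; rewrite smash_mapE // TK1.
  + exact: antipode_smashH.
- move=> D [Dd DDK DDH]; apply: funext => s.
  rewrite -[RHS](convolution_idK s (chom_lin (diff_chom Dd))).
  by apply: eq_tsum => s1 s2; rewrite (forced D).
Qed.
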